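(* Let $n\geq 2$, let $a_1,a_2,\dots,a_n$ be positive integers with $\gcd(a_1,\dots,a_n)=1$, and let $b$ be a non-negative integer. Consider the equation $$\sum_{i=1}^{n}a_ix_i=b,$$ and let $b'=\left[\frac{b}{2}\right]$. (i) Let $b$ be even. The equation is solvable in non-negative integers $x_1,\dots,x_n$ if and only if at least one of the numbers $P(b'-d'_i)$ $(i=1,2,\dots,l)$ is non-zero. (ii) Let $b$ be odd. The equation is solvable in non-negative integers $x_1,\dots,x_n$ if and only if at least one of the numbers $P(b'-c'_j)$ $(j=1,2,\dots,m)$ is non-zero.
   Context: $[x]$ denotes the largest integer not exceeding $x$. For an integer $t$, $P(t)$ denotes the number of solutions of $\sum_{i=1}^{n}a_ix_i=t$ in non-negative integers $x_1,\dots,x_n$ (so $P(t)=0$ for $t<0$). Let $$T=\Bigl\{\sum_{i=1}^{n}a_ix_i : x_i\in\{0,1\},\ i=1,2,\dots,n\Bigr\}.$$ Let $D=\{d_1,d_2,\dots,d_l\}$ be the set of all even elements of $T$ and $C=\{c_1,c_2,\dots,c_m\}$ the set of all odd elements of $T$. Put $d'_i=\frac{d_i}{2}$ for $i=1,\dots,l$ and $c'_j=\left[\frac{c_j}{2}\right]$ for $j=1,\dots,m$. *)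

(* Defs.v *)
From mathcomp Require Import all_boot all_order all_algebra.
From mathcomp Require Import finmap.
From mathcomp Require Import boolp classical_sets functions cardinality.

Set Implicit Arguments.
Unset Strict Implicit.
Unset Printing Implicit Defensive.

Local Open Scope classical_set_scope.
Local Open Scope nat_scope.

Definition lin_comb (n : nat) (a : 'I_n -> nat) (x : 'I_n -> nat) : nat :=
  \sum_(i < n) a i * x i.

Definition solutions (n : nat) (a : 'I_n -> nat) (t : int) :
    set {ffun 'I_n -> nat} :=
  [set x | (lin_comb a x)%:Z%R = t].

(* [fset_set] is the empty set on an infinite argument; [finite_solutions]
   shows that this default is never reached for positive coefficients. *)
Definition P_count (n : nat) (a : 'I_n -> nat) (t : int) : nat :=
  #|` fset_set (solutions a t)|.

Definition T_set (n : nat) (a : 'I_n -> nat) : set nat :=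
  [set lin_comb a (fun i => nat_of_bool (x i)) | x in [set: 'I_n -> bool]].

Definition D_set (n : nat) (a : 'I_n -> nat) : set nat :=
  T_set a `&` [set d | ~~ odd d].

Definition C_set (n : nat) (a : 'I_n -> nat) : set nat :=
  T_set a `&` [set c | odd c].

Lemma finite_solutions (n : nat) (a : 'I_n -> nat) (t : int) :
  (forall i, 0 < a i) -> finite_set (solutions a t).
Proof.
move=> a0; case: t => [k|k]; last first.
  by apply: (@sub_finite_set _ _ set0) => // x.
pose f (y : {ffun 'I_n -> 'I_k.+1}) : {ffun 'I_n -> nat} := [ffun i => y i : nat].
apply: (@sub_finite_set _ _ (f @` setT)); last first.
  by apply: finite_image; exact: finite_finset.
move=> x /= [xk]; exists [ffun i => inord (x i)] => //.
apply/ffunP => i; rewrite !ffunE inordK // ltnS -xk /lin_comb (bigD1 i) //=.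
by apply: leq_trans (leq_addr _ _); rewrite leq_pmull.
Qed.

(* Main.v *)
Require Import Defs.
From mathcomp Require Import all_boot all_order all_algebra.
From mathcomp Require Import boolp classical_sets.
From mathcomp Require Import finmap cardinality.
From mathcomp Require Import zify.

(** Write each unknown as x_i = e_i + 2 y_i with e_i in {0, 1} its parity.
    Then a solution of a . x = b is the same thing as a subset sum t = a . e
    in T together with a solution of 2 (a . y) = b - t.  The latter forces t
    and b to have the same parity, and two numbers of the same parity satisfy
    b - t = 2 ([b/2] - [t/2]), so that the equation for y is
    a . y = [b/2] - [t/2], whose solutions are counted by P.  Both parts of
    the theorem are instances of the resulting criterion
    [solvable_iff_same_parity], one for each parity of b.  Positivity of the
    coefficients makes the solution sets finite, so that a zero count does
    mean insolvability. *)

Local Open Scope nat_scope.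

Lemma P_count_neq0 (n : nat) (a : 'I_n -> nat) (t : int) :
  (forall i, 0 < a i) ->
  P_count a t <> 0 <-> exists y : {ffun 'I_n -> nat}, (lin_comb a y)%:Z%R = t.
Proof.
move=> a_gt0; rewrite /P_count.
have fin := finite_solutions t a_gt0.
split=> [/eqP|[y ay]].
  rewrite cardfs_eq0 => /fset0Pn[y].
  by rewrite in_fset_set // => /set_mem ay; exists y.
apply/eqP; rewrite cardfs_eq0; apply/fset0Pn; exists y.
by rewrite in_fset_set //; apply: mem_set.
Qed.

Lemma lin_comb_parity_half (n : nat) (a x : 'I_n -> nat) :
  lin_comb a x =
    lin_comb a (fun i => nat_of_bool (odd (x i))) +
    2 * lin_comb a (fun i => (x i)./2).
Proof.
rewrite /lin_comb big_distrr -big_split /=.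
by apply: eq_bigr => i _; rewrite mulnCA mul2n -mulnDr odd_double_half.
Qed.

Lemma lin_comb_add_double (n : nat) (a x y : 'I_n -> nat) :
  lin_comb a (fun i => x i + 2 * y i) = lin_comb a x + 2 * lin_comb a y.
Proof.
rewrite /lin_comb big_distrr -big_split /=.
by apply: eq_bigr => i _; rewrite mulnDr (mulnCA 2).
Qed.

(** The parities of the unknowns give the subset sum, their halves give the
    solution counted by P; the parity condition on t is what lets the halved
    equation be read back as an equation for b. *)
Lemma solvable_iff_same_parity (n : nat) (a : 'I_n -> nat) (b : nat) :
  (forall i, 0 < a i) ->
  (exists x : {ffun 'I_n -> nat}, lin_comb a x = b) <->
  (exists t : nat, [/\ T_set a t, odd t = odd b &
     P_count a ((b %/ 2)%:Z - (t %/ 2)%:Z)%R <> 0]).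
Proof.
move=> a_gt0; split=> [[x axb]|[t [[e _ ae] odd_t]]].
  pose y : {ffun 'I_n -> nat} := [ffun i => (x i)./2].
  have ay : lin_comb a y = lin_comb a (fun i => (x i)./2).
    by apply: eq_bigr => i _; rewrite ffunE.
  move: (lin_comb_parity_half n a x); rewrite -ay axb => {axb ay}.
  set t := lin_comb a (fun i => odd (x i)) => bE.
  exists t; split; first by exists (fun i => odd (x i)).
    by lia.
  by apply/P_count_neq0 => //; exists y; lia.
move=> /(P_count_neq0 _ _ _ a_gt0)[y ay].
exists [ffun i => nat_of_bool (e i) + 2 * y i].
transitivity (t + 2 * lin_comb a y); last by lia.
rewrite -ae -lin_comb_add_double.
by apply: eq_bigr => i _; rewrite ffunE.
Qed.

Theorem theorem2p21 (n : nat) (a : 'I_n -> nat) (b : nat)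
    (hn : 2 <= n) (ha : forall i : 'I_n, 0 < a i)
    (hgcd : \big[gcdn/0]_(i < n) a i = 1) :
  (~~ odd b ->
     ((exists x : {ffun 'I_n -> nat}, \sum_(i < n) a i * x i = b) <->
      (exists d : nat,
         D_set a d /\ P_count a ((b %/ 2)%:Z - (d %/ 2)%:Z)%R <> 0))) /\
  (odd b ->
     ((exists x : {ffun 'I_n -> nat}, \sum_(i < n) a i * x i = b) <->
      (exists c : nat,
         C_set a c /\ P_count a ((b %/ 2)%:Z - (c %/ 2)%:Z)%R <> 0))).
Proof.
have [solvP Psolv] := solvable_iff_same_parity n a b ha.
split=> odd_b; split.
- move=> /solvP[t [Tt odd_t Pt]]; exists t; split=> //.
  by split=> //=; rewrite odd_t.
- move=> [t [[Tt /= odd_t] Pt]]; apply: Psolv; exists t; split=> //.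
  by rewrite (negbTE odd_t) (negbTE odd_b).
- move=> /solvP[t [Tt odd_t Pt]]; exists t; split=> //.
  by split=> //=; rewrite odd_t.
- move=> [t [[Tt /= odd_t] Pt]]; apply: Psolv; exists t; split=> //.
  by rewrite odd_t odd_b.
Qed.
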